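(* Let $\pi$ be a $\sigma$-contractive linear map from a normed $*$-algebra $A$ to a normed space. Then: (i) $\pi$ is contractive in the auxiliary $*$-norm on $A$; (ii) $|\pi(a)|\leq \mathrm{r}_\lambda(a)\leq|a|$ for all Hermitian $a\in A$; (iii) $\pi$ is contractive on $A_{sa}$.
   Context: All algebras are complex. A normed $*$-algebra is a $*$-algebra equipped with a submultiplicative norm $|\cdot|$ (the involution need not be continuous, the norm need not be complete). $A_{sa}=\{a\in A:a=a^*\}$ is the set of Hermitian elements. The auxiliary $*$-norm on $A$ is $\|a\|=\sup\{|a|,|a^*|\}$. For $a\in A$: $\mathrm{r}_\lambda(a)=\inf_{n\geq1}|a^n|^{1/n}$, $\mathrm{r}_\sigma(a)=\mathrm{r}_\lambda(a^*a)^{1/2}$. A linear map $\pi$ from $A$ to a normed space (norm also written $|\cdot|$) is $\sigma$-contractive if $|\pi(a)|\leq \mathrm{r}_\sigma(a)$ for all $a\in A$. A (real-)linear map between normed spaces is contractive if it is bounded with norm not exceeding $1$; contractive on $A_{sa}$ means $|\pi(a)|\le|a|$ for all $a\in A_{sa}$. *)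

(* Defs.v *)
From HB Require Import structures.
From mathcomp Require Import all_boot all_order all_algebra.
From mathcomp Require Import all_classical all_reals all_analysis.
From mathcomp Require Import complex.

Set Implicit Arguments.
Unset Strict Implicit.
Unset Printing Implicit Defensive.

Import Order.TTheory GRing.Theory Num.Theory.
Import numFieldNormedType.Exports.

Local Open Scope classical_set_scope.
Local Open Scope ring_scope.
Local Open Scope complex_scope.

(* The algebra need not have a unit, so the product is not MathComp's ring
   multiplication. Neither completeness nor continuity of the involution is
   assumed. *)
HB.mixin Record NormedModule_isNormedStarAlgebra (R : realType) A
    & NormedModule R[i] A := {
  amul : A -> A -> A;
  star : A -> A;
  amulA : associative amul;
  amulDl : left_distributive amul +%R;
  amulDr : right_distributive amul +%R;
  amulZl : forall (k : R[i]) (a b : A), amul (k *: a) b = k *: amul a b;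
  amulZr : forall (k : R[i]) (a b : A), amul a (k *: b) = k *: amul a b;
  starK : involutive star;
  starD : {morph star : a b / a + b};
  starZ : forall (k : R[i]) (a : A), star (k *: a) = k^* *: star a;
  starM : forall a b : A, star (amul a b) = amul (star b) (star a);
  amul_norm_le : forall a b : A, `|amul a b| <= `|a| * `|b|
}.

#[short(type="normedStarAlgType")]
HB.structure Definition NormedStarAlgebra (R : realType) :=
  {A of NormedModule R[i] A & NormedModule_isNormedStarAlgebra R A}.

(* The norm of a [normedModType R[i]] takes its values in R[i] (they are real
   and nonnegative there); [rnorm] is the same norm as an element of R. *)
Definition rnorm (R : realType) (V : normedModType R[i]) (x : V) : R :=
  complex.Re `|x|.

Section NormedStarAlgebra.
Context {R : realType} {A : normedStarAlgType R}.
Implicit Types a : A.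

Definition hermitian_set : set A := [set a | a = star a].

Definition aux_norm a : R := Num.max (rnorm a) (rnorm (star a)).

(* a ^ n, meaningful for n >= 1 only; the value at n = 0 is junk. *)
Definition apow a (n : nat) : A := iterop n amul a 0.

Definition r_lambda a : R :=
  inf [set rnorm (apow a n) `^ n%:R^-1 | n in [set n | (1 <= n)%N]].

Definition r_sigma a : R := Num.sqrt (r_lambda (amul (star a) a)).

Definition sigma_contractive (V : normedModType R[i]) (f : A -> V) : Prop :=
  forall a, rnorm (f a) <= r_sigma a.

Definition contractive_on_hermitian (V : normedModType R[i]) (f : A -> V) :
  Prop := forall a, hermitian_set a -> rnorm (f a) <= rnorm a.

End NormedStarAlgebra.

(* The norm N on the domain is explicit, because the domain will be equipped
   with a norm other than its structural one. *)
Section Contractive.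
Context {R : realType} {U V : normedModType R[i]} (N : U -> R) (f : U -> V).

Definition bounded_map : Prop := exists c : R, forall x, rnorm (f x) <= c * N x.

Definition operator_norm : R := sup [set rnorm (f x) | x in [set x | N x <= 1]].

Definition contractive_for : Prop := bounded_map /\ operator_norm <= 1.

End Contractive.

(* Main.v *)
Require Import Defs.
From HB Require Import structures.
From mathcomp Require Import all_boot all_order all_algebra.
From mathcomp Require Import all_classical all_reals all_analysis.
From mathcomp Require Import complex.

(** The map [pi] is dominated by [r_sigma], so each claim follows from an upper
    bound on [r_sigma].

    For every [a], the first term of the infimum defining [r_lambda] gives
    [r_lambda b <= |b|]; with [b = a^* a] and submultiplicativity this yields
    [r_sigma a ^ 2 <= |a^*| |a| <= ||a|| ^ 2], hence contractivity in the
    auxiliary norm.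

    For Hermitian [a] one has [a^* a = a^2] and [(a^2)^n = a^n a^n], so that
    [|(a^2)^n|^(1/n) <= (|a^n|^(1/n))^2] for each [n >= 1]. Comparing the two
    infima term by term gives [r_lambda (a^2) <= r_lambda a ^ 2], that is,
    [r_sigma a <= r_lambda a], and the latter is at most [|a|]. *)

Import Order.TTheory GRing.Theory Num.Theory.
Import numFieldNormedType.Exports.

Local Open Scope classical_set_scope.
Local Open Scope ring_scope.
Local Open Scope complex_scope.

Section RealNorm.
Context {R : realType} {V : normedModType R[i]}.
Implicit Types x : V.

Lemma normE_rnorm x : `|x| = (rnorm x)%:C.
Proof.
rewrite /rnorm; have := normr_ge0 x.
by case: `|x| => r i; rewrite lecE /= => /andP[/eqP-> _].
Qed.

Lemma rnorm_ge0 x : 0 <= rnorm x.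
Proof. by rewrite -lecR -normE_rnorm normr_ge0. Qed.

Lemma rnorm0 : rnorm (0 : V) = 0.
Proof. by rewrite /rnorm normr0. Qed.

End RealNorm.

Section SpectralRadii.
Context {R : realType} {A : normedStarAlgType R}.
Implicit Types a b : A.

Lemma rnorm_amul a b : rnorm (amul a b) <= rnorm a * rnorm b.
Proof. by rewrite -lecR rmorphM /= -!normE_rnorm amul_norm_le. Qed.

Lemma apowS a n : apow a n.+2 = amul a (apow a n.+1).
Proof. by rewrite /apow !iteropS. Qed.

Lemma apow_comm a n : amul (apow a n.+1) a = amul a (apow a n.+1).
Proof. by elim: n => [//|n IHn]; rewrite apowS -amulA IHn. Qed.

Lemma apow_square a n :
  apow (amul a a) n.+1 = amul (apow a n.+1) (apow a n.+1).
Proof.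
elim: n => [//|n IHn]; rewrite !apowS IHn.
by rewrite -!amulA; congr amul; rewrite !amulA apow_comm.
Qed.

Lemma r_lambda_le_root a n :
  (0 < n)%N -> r_lambda a <= rnorm (apow a n) `^ n%:R^-1.
Proof.
move=> n_gt0; apply: ge_inf; last by exists n.
by exists 0 => _ [m _ <-]; exact: powR_ge0.
Qed.

Lemma le_r_lambda a c :
  (forall n, (0 < n)%N -> c <= rnorm (apow a n) `^ n%:R^-1) -> c <= r_lambda a.
Proof.
move=> c_le; apply: lb_le_inf; first by exists (rnorm (apow a 1) `^ 1%:R^-1), 1%N.
by move=> _ [n n_gt0 <-]; exact: c_le.
Qed.

Lemma r_lambda_le_rnorm a : r_lambda a <= rnorm a.
Proof.
have := @r_lambda_le_root a 1 isT.
by rewrite invr1 powRr1 // rnorm_ge0.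
Qed.

(** The [n]-th term for [amul a a] is at most the square of the [n]-th term for
    [a], by [apow_square] and submultiplicativity. *)
Lemma sqrt_r_lambda_square a : Num.sqrt (r_lambda (amul a a)) <= r_lambda a.
Proof.
apply: le_r_lambda => -[//|n] _.
set s := rnorm (apow a n.+1) `^ _.
have s_ge0 : 0 <= s by exact: powR_ge0.
rewrite -(ger0_norm s_ge0) -sqrtr_sqr ler_wsqrtr //.
apply: le_trans (@r_lambda_le_root _ n.+1 isT) _.
rewrite apow_square expr2 -powRM ?rnorm_ge0 //.
by rewrite ge0_ler_powR ?nnegrE ?invr_ge0 ?mulr_ge0 ?rnorm_ge0 ?rnorm_amul.
Qed.

Lemma r_sigma_hermitian a : hermitian_set a -> r_sigma a <= r_lambda a.
Proof. by move=> /= a_sa; rewrite /r_sigma -a_sa sqrt_r_lambda_square. Qed.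

Lemma r_sigma_le_aux_norm a : r_sigma a <= aux_norm a.
Proof.
have aux_ge0 : 0 <= aux_norm a by rewrite le_max rnorm_ge0.
rewrite -(ger0_norm aux_ge0) -sqrtr_sqr ler_wsqrtr //.
apply: le_trans (r_lambda_le_rnorm _) _; apply: le_trans (rnorm_amul _ _) _.
by rewrite expr2 ler_pM ?rnorm_ge0 // le_max lexx ?orbT.
Qed.

End SpectralRadii.

(** The bound at [0] makes the set defining the operator norm nonempty, so that
    its supremum is a genuine one. *)
Lemma contractive_for_le {R : realType} {U V : normedModType R[i]}
    (N : U -> R) (f : U -> V) :
  N 0 <= 1 -> (forall x, rnorm (f x) <= N x) -> contractive_for N f.
Proof.
move=> N0 f_le; split; first by exists 1 => x; rewrite mul1r.
apply: ge_sup; first by exists (rnorm (f 0)), 0.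
by move=> _ [x /= Nx_le1 <-]; exact: le_trans (f_le x) Nx_le1.
Qed.

Theorem theorem22p7 (R : realType) (A : normedStarAlgType R)
    (V : normedModType R[i]) (pi : {linear A -> V})
    (pi_sigma : sigma_contractive pi) :
  contractive_for aux_norm pi /\
  (forall a : A, hermitian_set a ->
    rnorm (pi a) <= r_lambda a /\ r_lambda a <= rnorm a) /\
  contractive_on_hermitian pi.
Proof.
have pi_herm a : hermitian_set a -> rnorm (pi a) <= r_lambda a.
  by move=> /r_sigma_hermitian; exact: le_trans (pi_sigma a).
split; last split.
- apply: contractive_for_le => [|a].
    have star0 : star (0 : A) = 0 by apply: (addrI (star 0)); rewrite -starD !addr0.
    by rewrite /aux_norm star0 rnorm0 maxxx ler01.
  exact: le_trans (pi_sigma a) (r_sigma_le_aux_norm a).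
- by move=> a a_sa; split; [exact: pi_herm | exact: r_lambda_le_rnorm].
- by move=> a /pi_herm /le_trans; apply; exact: r_lambda_le_rnorm.
Qed.
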